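(* Let $n=2l$ be even and let $\Omega_n(f,h)=\{B_n(\nabla^\alpha df,\nabla^\beta dh)+C_n(R,df,dh)\}\,dx$ be the universal decomposition described in the context. If $M$ is a flat (oriented, compact, without boundary) Riemannian manifold of dimension $n$, then $$\Omega_n(f,h)=B_n(\nabla^\alpha df,\nabla^\beta dh)\,dx$$ for all $f,h\in C^\infty(M)$.
   Context: Connes' Fredholm module of a conformal $n$-manifold: $\mathcal{H}=L^2(M,\Lambda^l_{\mathbb{C}}T^*M)$, on which functions act by multiplication, and $F=2P-1$, where $P$ is the orthogonal projection onto the image of $d$ in $\mathcal{H}$. $\Omega_n(f,h)=\operatorname{wres}([F,f][F,h])$, where for a classical pseudodifferential operator $P$ with homogeneous symbol components $\sigma^P_j$ in local coordinates $\operatorname{wres}(P)=\bigl\{\int_{|\xi|=1}\operatorname{trace}(\sigma_{-n}^P(x,\xi))\,d^{n-1}\xi\bigr\}\,dx$, with $|\xi|$ the Euclidean norm of the coordinate vector and $d^{n-1}\xi$ the normalized volume on $\{|\xi|=1\}$. Decomposition: fix a Riemannian metric in the conformal class, with curvature tensor $R$ and covariant differentiation $\nabla$. There are a universal (depending only on $n$) expression $B_n(\nabla^\alpha df,\nabla^\beta dh)$, bilinear in the covariant derivatives of $df$ and $dh$, with $|\alpha|+|\beta|=n-2$ and not involving curvature, and an expression $C_n(R,df,dh)$, linear in $f$ and in $h$, each monomial of which contains at least one factor of the curvature tensor or one of its covariant derivatives, such that $\Omega_n(f,h)=\{B_n(\nabla^\alpha df,\nabla^\beta dh)+C_n(R,df,dh)\}\,dx$.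 Since covariant derivatives do not commute, $B_n$ is fixed only up to ordering of derivatives; any ambiguity is absorbed in $C_n$. *)

(* Defs.v *)
From HB Require Import structures.
From mathcomp Require Import all_boot all_order all_algebra perm.
From mathcomp Require Import all_classical all_reals all_analysis.
From mathcomp Require Import complex.
Set Implicit Arguments. Unset Strict Implicit. Unset Printing Implicit Defensive.
Import Order.TTheory GRing.Theory Num.Theory numFieldNormedType.Exports.
Local Open Scope classical_set_scope.
Local Open Scope complex_scope.
Local Open Scope ring_scope.

(** * Calculus on R^n *)

Section Euclidean.
Context {R : realType}.

Definition cabs (z : R[i]) : R := Num.sqrt (complex.Re z ^+ 2 + complex.Im z ^+ 2).

Definition expi (t : R) : R[i] := Complex (cos t) (sin t).

Definition dot n (x y : 'rV[R]_n) : R := \sum_i x 0 i * y 0 i.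

(* The library's norm on ['rV_n] is the sup norm. *)
Definition enorm n (x : 'rV[R]_n) : R := Num.sqrt (dot x x).

Definition rpartial n (i : 'I_n) (F : 'rV[R]_n -> R) (x : 'rV[R]_n) : R :=
  'D_(delta_mx 0 i) F x.

Definition cpartial n (i : 'I_n) (F : 'rV[R]_n -> R[i]) (x : 'rV[R]_n) : R[i] :=
  Complex (rpartial i (fun y => complex.Re (F y)) x)
          (rpartial i (fun y => complex.Im (F y)) x).

Definition cpartials n (s : seq 'I_n) (F : 'rV[R]_n -> R[i]) : 'rV[R]_n -> R[i] :=
  foldr (@cpartial n) F s.

(* Used for open [D] only. *)
Definition smooth_on n (D : set 'rV[R]_n) (F : 'rV[R]_n -> R[i]) : Prop :=
  forall (s : seq 'I_n) (x : 'rV[R]_n), D x ->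
    differentiable (fun y => complex.Re (cpartials s F y)) x /\
    differentiable (fun y => complex.Im (cpartials s F y)) x.

(* Integral over R^n as an iterated Lebesgue integral: by Tonelli (for
   nonnegative Borel functions) and Fubini (for integrable ones) this is the
   integral against n-dimensional Lebesgue measure. *)
Fixpoint iint n : ('rV[R]_n -> \bar R) -> \bar R :=
  match n with
  | 0 => fun F => F 0
  | k.+1 => fun F =>
      (\int[lebesgue_measure]_t iint (fun v : 'rV[R]_k => F (row_mx t%:M v)))%E
  end.

Definition ciint n (F : 'rV[R]_n -> R[i]) : R[i] :=
  Complex (fine (iint (fun x => (complex.Re (F x))%:E)))
          (fine (iint (fun x => (complex.Im (F x))%:E))).

(* Mean of [F] over the Euclidean unit sphere, for the surface measure
   normalized to total mass 1, in polar coordinates: the mean over the unit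
   ball of the extension of [F] that is constant along rays. *)
Definition sphere_mean n (F : 'rV[R]_n -> R[i]) : R[i] :=
  let ball := [set xi : 'rV[R]_n | 0 < enorm xi <= 1] in
  ciint (fun xi => (\1_ball xi)%:C * F ((enorm xi)^-1 *: xi))
  / ciint (fun xi => (\1_ball xi)%:C).

End Euclidean.

(** * Closed oriented Riemannian manifolds *)

(* [chart c] and [param c] are total functions, meaningful on [dom c] and
   [cod c] respectively, where they are inverse to each other.  Second
   countability follows from compactness.  The base point of [carrier] has no
   role but to provide the library with a measurable space. *)
Record manifold (R : realType) (n : nat) := Manifold {
  carrier :> ptopologicalType;
  ix : Type;
  dom : ix -> set carrier;
  cod : ix -> set 'rV[R]_n;
  chart : ix -> carrier -> 'rV[R]_n;
  param : ix -> 'rV[R]_n -> carrier;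
  chart_at : carrier -> ix;
  dom_chart_at : forall p, dom (chart_at p) p;
  open_dom : forall c, open (dom c);
  open_cod : forall c, open (cod c);
  chart_cod : forall c p, dom c p -> cod c (chart c p);
  param_dom : forall c x, cod c x -> dom c (param c x);
  chartK : forall c p, dom c p -> param c (chart c p) = p;
  paramK : forall c x, cod c x -> chart c (param c x) = x;
  chart_cont : forall c p, dom c p -> {for p, continuous (chart c)};
  param_cont : forall c x, cod c x -> {for x, continuous (param c)};
  transition_smooth : forall c c' j,
    smooth_on (cod c `&` param c @^-1` dom c')
      (fun x => (chart c' (param c x) 0 j)%:C);
  transition_oriented : forall c c' p, dom c p -> dom c' p ->
    0 < \det (jacobian (fun x => chart c' (param c x)) (chart c p));
  manifold_hausdorff : hausdorff_space carrier;
  manifold_compact : compact [set: carrier]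
}.

Section Manifold.
Context {R : realType} {n : nat}.
Implicit Types (M : manifold R n).

(* [(jac c c' p) i j] is the derivative of the j-th coordinate of [c'] with
   respect to the i-th coordinate of [c] (row-vector convention). *)
Definition jac M (c c' : ix M) (p : M) : 'M[R]_n :=
  jacobian (fun x => chart c' (param c x)) (chart c p).

Definition smooth_fun M (f : M -> R[i]) : Prop :=
  forall c, smooth_on (cod c) (fun x => f (param c x)).

(* Covariant tensor fields in components: [T c p I] is the component of index
   [I] at [p] in the chart [c].  For a field of rank k only the values at
   [p] in [dom c] and [size I = k] are meaningful. *)
Definition field M := ix M -> M -> seq 'I_n -> R[i].

Definition partial M (i : 'I_n) (c : ix M) (F : M -> R[i]) (p : M) : R[i] :=
  cpartial i (fun x => F (param c x)) (chart c p).

Definition fscal M (f : M -> R[i]) (u : field M) : field M :=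
  fun c p I => f p * u c p I.

Definition fsub M (u v : field M) : field M := fun c p I => u c p I - v c p I.

(* Alternating tensor fields of rank k, without regularity. *)
Definition is_form M (k : nat) (u : field M) : Prop :=
  (forall c c' p (I : k.-tuple 'I_n), dom c p -> dom c' p ->
     u c p I = \sum_(J : k.-tuple 'I_n)
       (\prod_(a < k) (jac c c' p (tnth I a) (tnth J a))%:C) * u c' p J) /\
  (forall c p (I : k.-tuple 'I_n) (s : 'S_k), dom c p ->
     u c p [tuple tnth I (s a) | a < k] = (-1) ^+ s * u c p I).

Definition smooth_form M (k : nat) (u : field M) : Prop :=
  is_form k u /\
  forall c (I : k.-tuple 'I_n), smooth_on (cod c) (fun x => u c (param c x) I).

Definition extd M (u : field M) : field M := fun c p I =>
  if I is i0 :: _ then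
    \sum_(a < size I) (-1) ^+ a *
      partial (nth i0 I a) c (fun q => u c q (take a I ++ drop a.+1 I)) p
  else 0.

End Manifold.

Notation borel M := (g_sigma_algebraType (@open (carrier M))).

(* [vol] is the Riemannian volume measure; [volE] determines it uniquely. *)
Record metric (R : realType) (n : nat) (M : manifold R n) := Metric {
  gmx : ix M -> M -> 'M[R]_n;
  gmx_sym : forall c p, dom c p -> (gmx c p)^T = gmx c p;
  gmx_pos : forall c p (v : 'rV[R]_n), dom c p -> v != 0 ->
    0 < (v *m gmx c p *m v^T) 0 0;
  gmx_smooth : forall c i j,
    smooth_on (cod c) (fun x => (gmx c (param c x) i j)%:C);
  gmx_trans : forall c c' p, dom c p -> dom c' p ->
    gmx c p = jac c c' p *m gmx c' p *m (jac c c' p)^T;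
  vol : {measure set (borel M) -> \bar R};
  volE : forall c (A : set (borel M)), measurable A -> A `<=` dom c ->
    vol A = iint (fun x => (\1_(cod c `&` param c @^-1` A) x
                            * Num.sqrt (\det (gmx c (param c x))))%:E)
}.

Section Riemannian.
Context {R : realType} {n : nat} {M : manifold R n} (g : metric M).
Implicit Types (u v w : field M) (f h : M -> R[i]) (c : ix M) (p : M).

(* The Riemannian volume element is [vdens c p] times the coordinate
   Lebesgue measure of the chart [c]. *)
Definition vdens c p : R := Num.sqrt (\det (gmx g c p)).

Definition ginv c p : 'M[R]_n := invmx (gmx g c p).

(** ** Levi-Civita connection and curvature *)

Definition dg c (i j k : 'I_n) p : R :=
  rpartial i (fun x => gmx g c (param c x) j k) (chart c p).

(* [christoffel c m i j] is Gamma^m_{ij}. *)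
Definition christoffel c (m i j : 'I_n) p : R :=
  2^-1 * \sum_k ginv c p m k * (dg c i j k p + dg c j i k p - dg c k i j p).

Definition dchristoffel c (k m i j : 'I_n) p : R :=
  rpartial k (fun x => christoffel c m i j (param c x)) (chart c p).

(* R^m_{kij} *)
Definition riem13 c (m k i j : 'I_n) p : R :=
  dchristoffel c i m j k p - dchristoffel c j m i k p
  + \sum_r (christoffel c m i r p * christoffel c r j k p
            - christoffel c m j r p * christoffel c r i k p).

Definition riem : field M := fun c p I =>
  if I is [:: m; k; i; j] then
    (\sum_r gmx g c p m r * riem13 c r k i j p)%:C
  else 0.

Definition flat : Prop :=
  forall c p (m k i j : 'I_n), dom c p -> riem c p [:: m; k; i; j] = 0.

Definition scalar_field f : field M := fun c p I => if I is [::] then f p else 0.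

(* The new index comes first: [nabla T c p (i :: I)] is nabla_i T_I. *)
Definition nabla u : field M := fun c p I =>
  if I is i :: J then
    partial i c (fun q => u c q J) p
    - \sum_(a < size J) \sum_(m < n)
        (christoffel c m i (nth i J a) p)%:C * u c p (set_nth i J a m)
  else 0.

(** ** The Hilbert space of square-integrable complex k-forms *)

(* The factor 1/k! accounts for summing over all multi-indices rather than
   the increasing ones. *)
Definition form_dot (k : nat) u v p : R[i] :=
  let c := chart_at p in
  (k`!%:R)^-1 * \sum_(I : k.-tuple 'I_n) \sum_(J : k.-tuple 'I_n)
    (\prod_(a < k) (ginv c p (tnth I a) (tnth J a))%:C) * u c p I * (v c p J)^*.

Definition form_normsq (k : nat) u : \bar R :=
  (\int[vol g]_p (complex.Re (form_dot k u u p))%:E)%E.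

Definition L2_dot (k : nat) u v : R[i] :=
  Complex (Rintegral (vol g) setT (fun p => complex.Re (form_dot k u v p)))
          (Rintegral (vol g) setT (fun p => complex.Im (form_dot k u v p))).

(* Elements of L^2 are handled through representatives. *)
Definition L2_form (k : nat) u : Prop :=
  [/\ is_form k u,
      forall c (I : k.-tuple 'I_n),
        measurable_fun (dom c : set (borel M)) (fun p => complex.Re (u c p I)) /\
        measurable_fun (dom c : set (borel M)) (fun p => complex.Im (u c p I))
    & (form_normsq k u < +oo)%E].

(* The image of d in the L^2-forms of degree [l], as a closed subspace. *)
Definition im_d (l : nat) v : Prop :=
  L2_form l v /\
  forall e : R, 0 < e ->
    exists w, smooth_form l.-1 w /\ (form_normsq l (fsub v (extd w)) < e%:E)%E.

Definition is_proj (l : nat) u v : Prop :=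
  im_d l v /\ forall w, im_d l w -> L2_dot l (fsub u v) w = 0.

Definition proj_d (l : nat) u : field M :=
  xget (fun _ _ _ => 0) [set v | is_proj l u v].

(** ** The Fredholm module *)

Definition Fop (l : nat) u : field M :=
  fun c p I => 2 * proj_d l u c p I - u c p I.

Definition commF (l : nat) f u : field M :=
  fsub (Fop l (fscal f u)) (fscal f (Fop l u)).

(** ** Classical pseudodifferential operators and the Wodzicki residue *)

(* In a chart the bundle of l-forms is trivialized by the increasing
   multi-indices of length l, i.e. by [enum A] for [A : {set 'I_n}] with
   [#|A| = l].  A matrix-valued function of (x, xi) is given by its entries,
   as functions on R^(n + n). *)
Definition symb := {set 'I_n} -> {set 'I_n} -> 'rV[R]_(n + n) -> R[i].

Definition fourier c u (B : {set 'I_n}) (xi : 'rV[R]_n) : R[i] :=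
  ciint (fun y => (\1_(cod c) y)%:C
                  * (expi (- dot y xi) * u c (param c y) (enum B))).

Definition op_symb (l : nat) c (sg : symb) u (A : {set 'I_n}) (x : 'rV[R]_n)
    : R[i] :=
  (((2 * pi) ^- n)%:C) *
  ciint (fun xi => expi (dot x xi) *
    \sum_(B : {set 'I_n} | #|B| == l) sg A B (row_mx x xi) * fourier c u B xi).

Definition op_kernel (l : nat) c (ker : symb) u (A : {set 'I_n})
    (x : 'rV[R]_n) : R[i] :=
  ciint (fun y => (\1_(cod c) y)%:C *
    \sum_(B : {set 'I_n} | #|B| == l)
      ker A B (row_mx x y) * u c (param c y) (enum B)).

Definition supported_in (l : nat) c u : Prop :=
  exists K : set M, [/\ compact K, K `<=` dom c &
    forall c' p (I : l.-tuple 'I_n), dom c' p -> ~ K p -> u c' p I = 0].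

(* [s] encodes a derivative in (x, xi); this is its order in xi. *)
Definition xi_order (s : seq 'I_(n + n)) : nat := count (fun i : 'I_(n + n) => (n <= i)%N) s.

(* [q] is O(|xi|^(d - |beta|)), with its derivatives of order beta in xi, for
   |xi| >= 1, locally uniformly in x; if [q] is smooth up to xi = 0 this is
   the estimate defining the symbols of order [d]. *)
Definition symb_bound (D : set 'rV[R]_n) (d : int) (q : 'rV[R]_(n + n) -> R[i])
    : Prop :=
  forall (K : set 'rV[R]_n) (s : seq 'I_(n + n)), compact K -> K `<=` D ->
  exists a : R, forall x xi, K x -> 1 <= enorm xi ->
    cabs (cpartials s q (row_mx x xi)) <= a * enorm xi ^ (d - (xi_order s)%:Z).

Definition homogeneous_symb (D : set 'rV[R]_n) (d : int)
    (q : 'rV[R]_(n + n) -> R[i]) : Prop :=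
  smooth_on [set z | D (lsubmx z) /\ rsubmx z != 0] q /\
  forall x xi (t : R), D x -> xi != 0 -> 0 < t ->
    q (row_mx x (t *: xi)) = (t ^ d)%:C * q (row_mx x xi).

(* In the chart [c], [T] is a classical pseudodifferential operator of order
   [m] on l-forms, with homogeneous components [comp d] of degree [d]: it is
   Op(sg) up to a smoothing operator, and sg has the asymptotic expansion
   comp m + comp (m - 1) + ... *)
Definition classical_pdo (l : nat) (T : field M -> field M) c (m : int)
    (comp : int -> symb) : Prop :=
  exists sg ker : symb,
  (forall A B : {set 'I_n}, #|A| = l -> #|B| = l ->
    [/\ smooth_on [set z | cod c (lsubmx z)] (sg A B),
        smooth_on [set z | cod c (lsubmx z) /\ cod c (rsubmx z)] (ker A B),
        forall d, homogeneous_symb (cod c) d (comp d A B),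
        forall d z, m < d -> comp d A B z = 0
      & forall N : nat, symb_bound (cod c) (m - N%:Z)
          (fun z => sg A B z - \sum_(j < N) comp (m - j%:Z) A B z)]) /\
  forall u, smooth_form l u -> supported_in l c u ->
    {ae vol g, forall p, dom c p -> forall A : {set 'I_n}, #|A| = l ->
      T u c p (enum A) = op_symb l c sg u A (chart c p)
                         + op_kernel l c ker u A (chart c p)}.

(* [wres l T c p] is the coefficient of the density wres(T) with respect to
   the coordinate dx of the chart [c] (0 if [T] is not a classical
   pseudodifferential operator there; the homogeneous components are
   determined by [T]). *)
Definition wres (l : nat) (T : field M -> field M) c p : R[i] :=
  xget 0 [set w | exists (m : int) (comp : int -> symb),
    classical_pdo l T c m comp /\
    w = sphere_mean (fun xi => \sum_(A : {set 'I_n} | #|A| == l)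
          comp (- n%:Z) A A (row_mx (chart c p) xi))].

Definition Omega (l : nat) f h c p : R[i] :=
  wres l (fun u => commF l f (commF l h u)) c p.

End Riemannian.

(** * Universal expressions *)

(* The monomial
     coef * contraction of nabla^fo(df) (x) nabla^ho(dh)
              (x) nabla^k1(Riem) (x) ... (x) nabla^kr(Riem),  curv = [k1; ...; kr].
   The index slots of the factors are numbered consecutively from 0, and
   [pairing] lists the pairs of slots contracted with the inverse metric. *)
Record monomial (R : realType) := Monomial {
  coef : R[i];
  fo : nat;
  ho : nat;
  curv : seq nat;
  pairing : seq (nat * nat)
}.

Section Expressions.
Context {R : realType}.
Implicit Types (t : monomial R).

Definition ranks t : seq nat :=
  (fo t).+1 :: (ho t).+1 :: [seq (k + 4)%N | k <- curv t].

Definition complete_contraction t : bool :=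
  perm_eq (flatten [seq [:: q.1; q.2] | q <- pairing t])
          (iota 0 (sumn (ranks t))).

Definition expr := seq (monomial R).

Definition B_expr (n : nat) (B : expr) : bool :=
  all (fun t => [&& complete_contraction t, nilp (curv t)
                  & fo t + ho t == n - 2]%N) B.

Definition C_expr (C : expr) : bool :=
  all (fun t => complete_contraction t && ~~ nilp (curv t)) C.

Section Eval.
Context {n : nat} {M : manifold R n} (g : metric M).

Definition factors t (f h : M -> R[i]) : seq (field M) :=
  iter (fo t).+1 (nabla g) (scalar_field f)
  :: iter (ho t).+1 (nabla g) (scalar_field h)
  :: [seq iter k (nabla g) (riem g) | k <- curv t].

Definition contract_slots (c : ix M) (p : M) (I : seq 'I_n) (q : nat * nat) : R[i] :=
  if I is i0 :: _ then (ginv g c p (nth i0 I q.1) (nth i0 I q.2))%:C else 0.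

Definition eval_monomial t f h (c : ix M) (p : M) : R[i] :=
  coef t * \sum_(I : (sumn (ranks t)).-tuple 'I_n)
    (\prod_(q <- pairing t) contract_slots c p I q)
    * \prod_(x <- zip (factors t f h) (reshape (ranks t) I)) x.1 c p x.2.

Definition eval_expr (E : expr) f h (c : ix M) (p : M) : R[i] :=
  \sum_(t <- E) eval_monomial t f h c p.

End Eval.

Definition universal_decomposition (n l : nat) (B C : expr) : Prop :=
  [/\ B_expr n B, C_expr C &
    forall (M : manifold R n) (g : metric M) (f h : M -> R[i]),
      smooth_fun f -> smooth_fun h ->
      forall c p, dom c p ->
        Omega g l f h c p
        = (eval_expr g B f h c p + eval_expr g C f h c p) * (vdens g c p)%:C].

End Expressions.

(* Main.v *)
(** On a chart of a flat manifold the curvature components vanish on an open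
    set, hence so do all their partial derivatives and, by induction, all
    their covariant derivatives.  Every monomial of [C] has such a factor. *)
Require Import Defs.
From mathcomp Require Import all_boot all_order all_algebra.
From mathcomp Require Import all_classical all_reals all_analysis.
From mathcomp Require Import complex.
Local Open Scope complex_scope.
Local Open Scope ring_scope.
Import GRing.Theory numFieldNormedType.Exports.

Lemma rpartial_near0 (R : realType) (n : nat) (i : 'I_n) (F : 'rV[R]_n -> R)
    (x : 'rV[R]_n) :
  (\forall y \near x, F y = 0) -> rpartial i F x = 0.
Proof.
move=> F0; rewrite /rpartial (near_eq_derive (g := cst 0)) //.
by rewrite derive_cst.
Qed.

Section FlatVanishing.
Context {R : realType} {n : nat} {M : manifold R n}.
Implicit Types (u : field M) (c : ix M) (p : M).

(** [param c] is controlled only on [cod c]; this set is open and contains [chart c p], so the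
    function being differentiated vanishes near that point. *)
Lemma partial_eq0 (F : M -> R[i]) (i : 'I_n) c p :
  (forall q, dom c q -> F q = 0) -> dom c p -> partial i c F p = 0.
Proof.
move=> F0 cp; have near_cod : \forall y \near chart c p, cod c y.
  by apply: open_nbhs_nbhs; split; [exact: open_cod | exact: chart_cod].
by rewrite /partial /cpartial !rpartial_near0 //;
  apply: filterS near_cod => y cy; rewrite F0 //; exact: param_dom.
Qed.

Variable g : metric M.

(** Vanishing is assumed on all of [dom c], since the derivative term sees nearby points; the
    Christoffel terms are linear in the values of [u] at [p]. *)
Lemma nabla_eq0 u c :
  (forall p I, dom c p -> u c p I = 0) ->
  forall p I, dom c p -> nabla g u c p I = 0.
Proof.
move=> u0 p [|i J] cp //=.
rewrite partial_eq0 => [|q cq|//]; last exact: u0.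
rewrite big1 ?subr0 // => a _; rewrite big1 // => m _.
by rewrite u0 // mulr0.
Qed.

Lemma iter_nabla_riem_eq0 k c p I :
  flat g -> dom c p -> iter k (nabla g) (riem g) c p I = 0.
Proof.
move=> g_flat; elim: k p I => [|k IHk] p I cp; last exact: nabla_eq0.
(* Flatness covers index lists of length 4; on any other length [riem] takes its default value 0. *)
case: I => [|m [|j [|i [|r [|]]]]] //; exact: g_flat.
Qed.

Lemma eval_monomial_flat (t : monomial R) (f h : M -> R[i]) c p :
  flat g -> ~~ nilp (curv t) -> dom c p -> eval_monomial g t f h c p = 0.
Proof.
case: t => a r s [//|k ks] prs g_flat _ cp.
rewrite /eval_monomial big1 ?mulr0 // => I _.
(* The factors from [f] and [h] come first; the third is the [k]-th covariant derivative of the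
   curvature, which kills the product. *)
by rewrite /factors /ranks /= !big_cons /= iter_nabla_riem_eq0 // mul0r !mulr0.
Qed.

Lemma eval_expr_flat (C : @expr R) (f h : M -> R[i]) c p :
  flat g -> C_expr C -> dom c p -> eval_expr g C f h c p = 0.
Proof.
move=> g_flat + cp; rewrite /eval_expr.
elim: C => [|t C IHC] /=; first by rewrite big_nil.
case/andP=> /andP[_ t_curv] /IHC C0.
by rewrite big_cons C0 addr0; exact: eval_monomial_flat.
Qed.

End FlatVanishing.

Theorem lemma5p2 (R : realType) (n l : nat) (B C : @expr R)
    (l_gt0 : (0 < l)%N) (n_even : n = (2 * l)%N)
    (BC_universal : universal_decomposition n l B C)
    (M : manifold R n) (g : metric M) (M_flat : flat g)
    (f h : M -> R[i]) (f_smooth : smooth_fun f) (h_smooth : smooth_fun h)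
    (c : ix M) (p : M) (dom_p : dom c p) :
  Omega g l f h c p = eval_expr g B f h c p * (vdens g c p)%:C.
Proof.
case: BC_universal => _ CC ->//.
by rewrite (eval_expr_flat g C) // addr0.
Qed.
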